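(* Let $L\in\hat{\mathscr W}$ be a single-slope differential operator with the rational slope $r=p/q$, $\gcd(p,q)=1$, and assume that the roots $\lambda_1,\dots,\lambda_m\in\mathbb C$ of the corresponding characteristic polynomial $\sigma_L$ are nonresonant, i.e., pairwise different. Then the operator $L$ can be formally decomposed as a noncommutative product of $m$ irreducible operators, $L=L_1\cdots L_m$, with the same slope $r$, having the form $L_j=t^p\epsilon^q-\lambda_j+\cdots$.
   Context: $\hat{\mathscr W}$ is the noncommutative $\mathbb C$-algebra of formal differential operators: formal series in $t$ and $\epsilon$, polynomial in $\epsilon$, where $\epsilon=t\frac{d}{dt}$ is the Euler derivation, multiplication is composition, and $\epsilon^j t^k=t^k(\epsilon+k)^j$. Every $L\in\hat{\mathscr W}$ is written uniquely with powers of $t$ on the left: $L=\sum_{(i,j)}c_{ij}t^j\epsilon^i$ with $0\le i\le n$, $j\ge 0$, where $n$ is the order of $L$. The support of $L$ is $\{(i,j):c_{ij}\ne0\}$, and the pseudosymbol of $L$ is the commutative expression $\sum c_{ij}t^j\xi^i\in\mathbb C[[t]][\xi]$. The Newton polygon $\Delta_L\subset\mathbb R_+^2$ is the minimal closed convex set which contains the origin $(0,0)$ and the support of $L$ and is invariant under the translation $(i,j)\mapsto(i,j+1)$. It is the epigraph of a convex non-decreasing piecewise-affine function $\chi:[0,n]\to\mathbb R_+$ with $\chi(0)=0$. $L$ is single-slope with slope $\rho\in\mathbb Q$, $\rho\ge0$, if the set of slopes of the affine pieces of $\chi$ is $\{\rho\}$, i.e., $\chi(x)=\rho x$; the value $\rho=0$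 is not excluded. For a single-slope $L$ with slope $\rho=p/q$ in lowest terms ($p=0$, $q=1$ if $\rho=0$), give the monomial $t^j\xi^i$ the weight $j-\rho i$. The leading part $P_*$ of the pseudosymbol is the sum of its terms of minimal weight. It is written uniquely as $P_*(t,\xi)=c\,t^j\xi^i\prod_{s=1}^k(\lambda_s-t^p\xi^q)$ with $c\prod_s\lambda_s\neq0$. The characteristic polynomial $\sigma_L\in\mathbb C[\lambda]$ is the univariate polynomial $c\prod_{s=1}^k(\lambda_s-\lambda)$, whose (nonzero) roots are $\lambda_1,\dots,\lambda_k$. The dots in $L_j=t^p\epsilon^q-\lambda_j+\cdots$ denote terms $c_{ik}t^k\epsilon^i$ of higher weight $k-ri>0$. Irreducible is understood in the usual sense: not a product of two operators of positive order.
   Formalization: L is assumed to have nonzero constant term (no monomial factor in its leading part; L=ε is a counterexample), the product carries the leading coefficient of σ_L as a constant factor (L=2(ε-1)), and for slope 0 the roots may be reordered. *)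

(* Defs.v *)
From HB Require Import structures.
From mathcomp Require Import all_boot all_order all_algebra all_fingroup.
From mathcomp Require Import all_classical all_reals all_analysis.
From mathcomp Require Import complex.

Set Implicit Arguments.
Unset Strict Implicit.
Unset Printing Implicit Defensive.

Import Order.TTheory GRing.Theory Num.Theory.
Import numFieldNormedType.Exports.

Local Open Scope classical_set_scope.
Local Open Scope ring_scope.

(* A formal differential operator is stored as k |-> P_k, standing for
   \sum_k t^k P_k(eps) with powers of t on the left; the degrees of the P_k
   are bounded uniformly in k, i.e. the series is polynomial in eps. *)
Definition bounded_degree (F : fieldType) : {pred nat -> {poly F}} :=
  fun f => `[< exists n, forall k, (size (f k) <= n)%N >].

Record fdo (F : fieldType) :=
  Fdo { fdo_val :> nat -> {poly F}; fdo_valP : fdo_val \in @bounded_degree F }.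

HB.instance Definition _ (F : fieldType) := [isSub for @fdo_val F].
HB.instance Definition _ (F : fieldType) := [Choice of fdo F by <:].

Section FdoAlgebra.
Variable F : fieldType.
Implicit Types (L M N : fdo F) (P Q : {poly F}).

Lemma bounded_degreeP (f : nat -> {poly F}) :
  reflect (exists n, forall k, (size (f k) <= n)%N) (f \in @bounded_degree F).
Proof. exact: asboolP. Qed.

Lemma bounded_degree_submod : submod_closed (@bounded_degree F).
Proof.
split=> [|a f g /bounded_degreeP[n Hn] /bounded_degreeP[m Hm]].
  by apply/bounded_degreeP; exists 0%N => k; rewrite size_poly0.
apply/bounded_degreeP; exists (maxn n m) => k.
rewrite (leq_trans (size_polyD _ _)) // geq_max.
rewrite (leq_trans (size_scale_leq _ _)) /=; last first.
  by rewrite (leq_trans (Hn k)) ?leq_maxl.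
by rewrite (leq_trans (Hm k)) ?leq_maxr.
Qed.

HB.instance Definition _ :=
  GRing.isSubmodClosed.Build F (nat -> {poly F}) (@bounded_degree F)
    bounded_degree_submod.
HB.instance Definition _ := [SubChoice_isSubZmodule of fdo F by <:].
HB.instance Definition _ := [SubNmodule_isSubLSemiModule of fdo F by <:].

Lemma fdo_eqP L M : (forall k, L k = M k) <-> L = M.
Proof.
split=> [LM|->//]; apply: val_inj; apply/funext => k; exact: LM.
Qed.

Lemma fdoD L M k : (L + M) k = L k + M k. Proof. by []. Qed.
Lemma fdoN L k : (- L) k = - L k. Proof. by []. Qed.
Lemma fdoZ a L k : (a *: L) k = a *: L k. Proof. by []. Qed.
Lemma fdo0 k : (0 : fdo F) k = 0. Proof. by []. Qed.

(* P(eps) t^k = t^k (eshift k P)(eps), by eps t^k = t^k (eps + k). *)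
Definition eshift (k : nat) P : {poly F} := P \Po ('X + k%:R%:P).

Lemma size_eshift k P : size (eshift k P) = size P.
Proof. by rewrite /eshift size_comp_poly2 // size_XaddC. Qed.
Lemma eshift0 P : eshift 0 P = P.
Proof. by rewrite /eshift addr0 comp_polyXr. Qed.
Lemma eshiftD k P Q : eshift k (P + Q) = eshift k P + eshift k Q.
Proof. exact: comp_polyD. Qed.
Lemma eshiftZ k a P : eshift k (a *: P) = a *: eshift k P.
Proof. exact: comp_polyZ. Qed.
Lemma eshiftM k P Q : eshift k (P * Q) = eshift k P * eshift k Q.
Proof. exact: comp_polyM. Qed.
Lemma eshift_eshift j k P : eshift j (eshift k P) = eshift (k + j) P.
Proof.
rewrite /eshift -comp_polyA comp_polyD comp_polyX comp_polyC.
by rewrite -addrA -polyCD -natrD addnC.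
Qed.
Lemma eshift_1 k : eshift k 1 = 1. Proof. by rewrite /eshift -polyC1 comp_polyC. Qed.
Lemma eshift_0 k : eshift k 0 = 0. Proof. by rewrite /eshift comp_poly0. Qed.
Lemma eshift_sum k (I : Type) (r : seq I) (p : pred I) (G : I -> {poly F}) :
  eshift k (\sum_(i <- r | p i) G i) = \sum_(i <- r | p i) eshift k (G i).
Proof. exact: (big_morph _ (eshiftD k) (eshift_0 k)). Qed.

(* Composition: (\sum_j t^j P_j)(\sum_k t^k Q_k)
   = \sum_n t^n \sum_(j + k = n) P_j(eps + k) Q_k(eps). *)
Definition fdo_mul_val L M (n : nat) : {poly F} :=
  \sum_(j < n.+1) eshift (n - j) (L j) * M (n - j)%N.

Fact fdo_mul_subproof L M : fdo_mul_val L M \in @bounded_degree F.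
Proof.
have /bounded_degreeP[n Hn] := fdo_valP L.
have /bounded_degreeP[m Hm] := fdo_valP M.
apply/bounded_degreeP; exists (n + m)%N => k.
apply: (leq_trans (size_sum _ _ _)); apply/bigmax_leqP => j _.
apply: (leq_trans (size_polyMleq _ _)); rewrite size_eshift.
by apply: (leq_trans (leq_pred _)); apply: leq_add.
Qed.
Definition fdo_mul L M : fdo F := Fdo (fdo_mul_subproof L M).

Fact fdo_monom_subproof (k : nat) P :
  (fun n => if n == k then P else 0) \in @bounded_degree F.
Proof.
apply/bounded_degreeP; exists (size P) => n.
by case: ifP => // _; rewrite size_poly0.
Qed.
(* t^k P(eps) *)
Definition fdo_monom (k : nat) P : fdo F := Fdo (fdo_monom_subproof k P).

Lemma fdo_mul_rev L M n :
  fdo_mul L M n = \sum_(j < n.+1) eshift j (L (n - j)%N) * M j.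
Proof.
rewrite /= /fdo_mul_val (reindex_inj rev_ord_inj) /=.
by apply: eq_bigr => j _; rewrite (sub_ordK j).
Qed.

Fact fdo_mulA : associative fdo_mul.
Proof.
move=> p q r; apply/fdo_eqP => i; rewrite [RHS]fdo_mul_rev.
pose c3 j k := eshift (i - j) (p j) * (eshift k (q (i - j - k)%N) * r k).
transitivity (\sum_(j < i.+1) \sum_(k < i.+1 | (k <= i - j)%N) c3 j k).
  apply: eq_bigr => j _; rewrite (fdo_mul_rev q r) big_distrr /=.
  by rewrite (big_ord_narrow_leq (leq_subr _ _)).
rewrite (exchange_big_dep predT) //=; apply: eq_bigr => k _.
transitivity (\sum_(j < i.+1 | (j <= i - k)%N) c3 j k).
  apply: eq_bigl => j; rewrite -ltnS -(ltnS j) -!subSn ?leq_ord //.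
  by rewrite -subn_gt0 -(subn_gt0 j) -!subnDA addnC.
rewrite (big_ord_narrow_leq (leq_subr _ _)) /fdo_mul_val eshift_sum big_distrl /=.
apply: eq_bigr => j _; rewrite /c3 /= eshiftM eshift_eshift mulrA.
have jk : (j <= i - k)%N by rewrite -ltnS.
have ki : (k <= i)%N by rewrite -ltnS.
congr (eshift _ _ * eshift _ (q _) * _).
  rewrite subnAC subnK // leq_subRL ?(leq_trans jk) ?leq_subr // addnC.
  by rewrite -leq_subRL.
by rewrite subnAC.
Qed.

Fact fdo_mul1 : left_id (fdo_monom 0 1) fdo_mul.
Proof.
move=> L; apply/fdo_eqP => n; rewrite /= /fdo_mul_val big_ord_recl /= subn0.
by rewrite eshift_1 mul1r big1 ?addr0 // => j _; rewrite eshift_0 mul0r.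
Qed.

Fact fdo_mulr1 : right_id (fdo_monom 0 1) fdo_mul.
Proof.
move=> L; apply/fdo_eqP => n; rewrite fdo_mul_rev big_ord_recl /= subn0.
by rewrite eshift0 mulr1 big1 ?addr0 // => j _; rewrite mulr0.
Qed.

Fact fdo_mulDl : left_distributive fdo_mul +%R.
Proof.
move=> L M N; apply/fdo_eqP => n; rewrite fdoD /= /fdo_mul_val -big_split /=.
by apply: eq_bigr => j _; rewrite -mulrDl -eshiftD.
Qed.

Fact fdo_mulDr : right_distributive fdo_mul +%R.
Proof.
move=> L M N; apply/fdo_eqP => n; rewrite fdoD /= /fdo_mul_val -big_split /=.
by apply: eq_bigr => j _; rewrite -mulrDr.
Qed.

Fact fdo_1neq0 : fdo_monom 0 1 != 0.
Proof.
apply/eqP => /fdo_eqP /(_ 0%N) /= /eqP.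
by rewrite oner_eq0.
Qed.

HB.instance Definition _ := GRing.Zmodule_isNzRing.Build (fdo F)
  fdo_mulA fdo_mul1 fdo_mulr1 fdo_mulDl fdo_mulDr fdo_1neq0.

Fact fdo_scaleAl (a : F) L M : a *: (L * M) = (a *: L) * M.
Proof.
apply/fdo_eqP => n; rewrite fdoZ /= /fdo_mul_val scaler_sumr.
by apply: eq_bigr => j _; rewrite fdoZ eshiftZ scalerAl.
Qed.
HB.instance Definition _ := GRing.Lmodule_isLalgebra.Build F (fdo F) fdo_scaleAl.

Fact fdo_scaleAr (a : F) L M : a *: (L * M) = L * (a *: M).
Proof.
apply/fdo_eqP => n; rewrite fdoZ /= /fdo_mul_val scaler_sumr.
by apply: eq_bigr => j _; rewrite fdoZ scalerAr.
Qed.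
HB.instance Definition _ := GRing.Lalgebra_isAlgebra.Build F (fdo F) fdo_scaleAr.

Definition op_t : fdo F := fdo_monom 1 1.
Definition op_eps : fdo F := fdo_monom 0 'X.

Lemma fdo_monomM (j k : nat) P Q :
  fdo_monom j P * fdo_monom k Q = fdo_monom (j + k) (eshift k P * Q).
Proof.
apply/fdo_eqP => n /=; rewrite /fdo_mul_val /=; case: eqP => [->|njk].
  have jlt : (j < (j + k).+1)%N by rewrite ltnS leq_addr.
  rewrite (bigD1 (Ordinal jlt)) //= eqxx addKn eqxx big1 ?addr0 // => i.
  by rewrite -val_eqE /= => /negPf->; rewrite eshift_0 mul0r.
rewrite big1 // => i _; have [ij|_] := eqVneq (val i) j; last first.
  by rewrite eshift_0 mul0r.
have [nk|_] := eqVneq (n - i)%N k; last by rewrite mulr0.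
by case: njk; rewrite -ij -nk subnKC ?leq_ord.
Qed.

Lemma op_tX k : op_t ^+ k = fdo_monom k 1.
Proof.
elim: k => [//|k IHk]; rewrite exprS IHk fdo_monomM mulr1.
by rewrite eshift_1 add1n.
Qed.

Lemma op_epsX i : op_eps ^+ i = fdo_monom 0 'X^i.
Proof.
elim: i => [//|i IHi]; rewrite exprS IHi fdo_monomM.
by rewrite eshift0 addn0 -exprS.
Qed.

Lemma eps_t_comm j k : op_eps ^+ j * op_t ^+ k = op_t ^+ k * (op_eps + k%:R) ^+ j.
Proof.
have mX Q i : fdo_monom 0 Q ^+ i = fdo_monom 0 (Q ^+ i).
  by elim: i => [//|i IHi]; rewrite !exprS IHi fdo_monomM eshift0 addn0.
have -> : op_eps + k%:R = fdo_monom 0 ('X + k%:R%:P).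
  apply/fdo_eqP => n; rewrite fdoD -[k%:R]scaler_nat fdoZ /=.
  by case: eqP => _; rewrite ?scaler0 ?addr0 // -mul_polyC mulr1.
rewrite mX op_epsX op_tX !fdo_monomM mulr1 eshift_1 mul1r add0n addn0.
by congr fdo_monom; rewrite /eshift comp_Xn_poly.
Qed.

(* The coefficient of t^j eps^i. *)
Definition fcoef L (i j : nat) : F := (L j)`_i.

Fact order_exists L : exists n, `[< forall k, (size (L k) <= n.+1)%N >].
Proof.
have /bounded_degreeP[n Hn] := fdo_valP L.
by exists n; apply/asboolP => k; apply: leqW.
Qed.
(* The largest i such that some t^j eps^i occurs in L (0 if L = 0). *)
Definition order L : nat := ex_minn (order_exists L).

(* Not a product of two operators of positive order. *)
Definition irreducible_op L : Prop :=
  forall A B, L = A * B -> ~ ((0 < order A)%N /\ (0 < order B)%N).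

End FdoAlgebra.

Section NewtonPolygon.
Variable R : realType.
Local Notation C := R[i].
Implicit Types L : fdo C.

Definition support_op L : set (nat * nat) := [set ij | fcoef L ij.1 ij.2 != 0].

Definition newton_polygon L : set (R^o * R^o) :=
  smallest
    [set D : set (R^o * R^o) | [/\ closed D,
       convex_set (D : set (convex_lmodType (R^o * R^o)%type)) &
       forall x y, D (x, y) -> D (x, y + 1)]]
    ([set (0, 0)] `|` [set (ij.1%:R, ij.2%:R) | ij in support_op L]).

(* An operator of order 0 has no affine piece, hence no slope. *)
Definition single_slope L (rho : rat) : Prop :=
  [/\ (0 < order L)%N, 0 <= rho &
   newton_polygon L =
     [set z | 0 <= z.1 <= (order L)%:R /\ ratr rho * z.1 <= z.2]].

(* The weight of t^j xi^i. *)
Definition weight (rho : rat) (i j : nat) : rat := j%:R - rho * i%:R.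

Definition minimal_weight (rho : rat) L (i j : nat) : Prop :=
  forall i' j', support_op L (i', j') -> weight rho i j <= weight rho i' j'.

(* C = R[i]; P in C[t][xi] is the sum of the terms of minimal weight of L. *)
Definition leading_part (rho : rat) L (P : {poly {poly C}}) : Prop :=
  forall i j, P`_i`_j = if `[< minimal_weight rho L i j >] then fcoef L i j else 0.

(* C[t][xi] is {poly {poly C}}, with outer variable xi. *)
Definition var_xi : {poly {poly C}} := 'X.
Definition var_t : {poly {poly C}} := ('X : {poly C})%:P.

Definition characteristic_polynomial (p q : nat) L (sigma : {poly C}) : Prop :=
  exists (c : C) (i j : nat) (lambda : seq C),
    [/\ c * \prod_(l <- lambda) l != 0,
        leading_part (p%:R / q%:R) L
          (c%:P%:P * var_t ^+ j * var_xi ^+ i *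
             \prod_(l <- lambda) (l%:P%:P - var_t ^+ p * var_xi ^+ q)) &
        sigma = c%:P * \prod_(l <- lambda) (l%:P - 'X)].

(* L = t^p eps^q - lambda + (terms of positive weight with respect to p/q) *)
Definition elementary_form (p q : nat) (lambda : C) L : Prop :=
  forall i k,
    support_op (L - (op_t C ^+ p * op_eps C ^+ q - lambda%:A)) (i, k) ->
    0 < weight (p%:R / q%:R) i k.

End NewtonPolygon.

(* Main.v *)
Require Import Defs.
From mathcomp Require Import all_boot all_order all_algebra all_fingroup.
From mathcomp Require Import all_classical all_reals all_analysis.
From mathcomp Require Import complex.
From mathcomp Require Import zify ring.

(* Filter the operators by the weight [q * j - p * i] of their terms
   [t^j eps^i].  The terms of a given weight [d] form, up to terms of larger
   weight, a module of rank one over the polynomials in [t^p eps^q], on which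
   left multiplication by [t^p eps^q - lam] acts as multiplication by a linear
   polynomial: its root is [lam] if the slope is positive (the associated graded
   ring is then commutative) and [lam - d] if it is zero.  Splitting off a left
   factor is therefore a successive approximation whose linearised step is
   solvable as soon as none of these roots is a root of the complementary factor;
   for slope zero this is achieved by ordering the roots by real part.

   A factor with leading part [t^p eps^q - lam] is irreducible: if it is [A * B],
   then [A] and [B] have constant terms, so their minimal weights are nonpositive,
   and since terms of minimal weight multiply both are zero.  The top terms of
   [A] and [B] then lie on the edge from (0,0) to (q,p), which has no interior
   lattice point since [p] and [q] are coprime. *)

Set Implicit Arguments.
Unset Strict Implicit.
Unset Printing Implicit Defensive.

Import Order.TTheory GRing.Theory Num.Theory.
Import numFieldNormedType.Exports.
Local Open Scope classical_set_scope.
Local Open Scope ring_scope.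

(** * Coefficients of products *)

Section Products.
Variable F : fieldType.
Implicit Types (A B M : fdo F) (P : {poly F}).

Lemma coef_eshift_top k P i :
  (forall i', (i < i')%N -> P`_i' = 0) -> (eshift k P)`_i = P`_i.
Proof.
move=> P0; have szP : (size P <= i.+1)%N by apply/leq_sizeP.
case: (ltngtP (size P) i.+1) szP => // [szP|szP] _.
  by rewrite !nth_default ?size_eshift.
have -> : i = (size P).-1 by rewrite szP.
rewrite -{1}(size_eshift k P) -!lead_coefE lead_coef_comp ?size_XaddC //.
by rewrite lead_coefXaddC expr1n mulr1.
Qed.

Lemma eshift_coef_neq0 k P i :
  (eshift k P)`_i != 0 -> exists2 i', (i <= i')%N & P`_i' != 0.
Proof.
move=> Pi; have szP : (i < size P)%N.
  rewrite ltnNge; apply: contra Pi => szP.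
  by rewrite nth_default ?size_eshift.
exists (size P).-1; first by rewrite -ltnS (ltn_predK szP).
by rewrite -lead_coefE lead_coef_eq0 -size_poly_gt0 (leq_ltn_trans _ szP).
Qed.

Lemma fcoefM A B i j :
  fcoef (A * B) i j = \sum_(l < j.+1) \sum_(k < i.+1)
    (eshift (j - l) (A l))`_k * (B (j - l)%N)`_(i - k).
Proof. by rewrite /fcoef coef_sum; apply: eq_bigr => l _; rewrite coefM. Qed.

(** Powers of [t] add exactly, whereas moving [eps] past [t^k] replaces it by [eps + k] and so
    creates terms of lower order: hence an equality for [t] but only an inequality for [eps]. *)
Lemma fcoefM_neq0 A B i j : fcoef (A * B) i j != 0 ->
  exists i1 j1 i2 j2, [/\ fcoef A i1 j1 != 0, fcoef B i2 j2 != 0,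
    (i <= i1 + i2)%N & (j1 + j2 = j)%N].
Proof.
move=> ABij; apply: contrapT => noAB; case/eqP: ABij; rewrite fcoefM.
apply: big1 => l _; apply: big1 => k _; apply/eqP; apply: contrapT => /negP.
rewrite mulf_eq0 negb_or => /andP[/eshift_coef_neq0[k' kk' Ak'] Bk].
apply: noAB; exists k', (val l), (i - k)%N, (j - l)%N; split=> //.
- by rewrite -leq_subLR leq_sub2l.
- by rewrite subnKC ?leq_ord.
Qed.

(* Terms of [A] and [B] at which the linear form [b * j - a * i] attains its
   minimum exactly once are not cancelled in the product. *)
Lemma fcoefM_extremal a b A B iA jA iB jB :
    (forall i j, fcoef A i j != 0 -> (b * jA + a * i <= b * j + a * iA)%N /\
       ((b * jA + a * i = b * j + a * iA)%N -> i = iA /\ j = jA)) ->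
    (forall i j, fcoef B i j != 0 -> (b * jB + a * i <= b * j + a * iB)%N /\
       ((b * jB + a * i = b * j + a * iB)%N -> i = iB /\ j = jB)) ->
  fcoef (A * B) (iA + iB) (jA + jB) = fcoef A iA jA * fcoef B iB jB.
Proof.
move=> minA minB; rewrite fcoefM.
have uniq l k : (l <= jA + jB)%N -> (k <= iA + iB)%N ->
    (eshift (jA + jB - l) (A l))`_k * (B (jA + jB - l)%N)`_(iA + iB - k) != 0 ->
    l = jA /\ k = iA.
  move=> lJ kI; rewrite mulf_eq0 negb_or.
  case/andP=> /eshift_coef_neq0[k' kk' Ak'] Bk.
  have [leA eqA] := minA _ _ Ak'; have [leB eqB] := minB _ _ Bk.
  have e1 : (b * l + b * (jA + jB - l) = b * jA + b * jB)%N.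
    by rewrite -!mulnDr subnKC.
  have e2 : (a * iA + a * iB <= a * k' + a * (iA + iB - k))%N.
    by rewrite -!mulnDr leq_mul2l; apply/orP; right; lia.
  by have [] := eqA ltac:(lia); have [] := eqB ltac:(lia); lia.
have hj : (jA < (jA + jB).+1)%N by lia.
have hi : (iA < (iA + iB).+1)%N by lia.
rewrite (bigD1 (Ordinal hj)) //= [X in _ + X]big1 ?addr0; last first.
  move=> l ljA; apply: big1 => k _; apply/eqP; apply: contraNT ljA => nz.
  by have [|| + _] := uniq l k _ _ nz; rewrite ?leq_ord // => e; apply/eqP/val_inj.
rewrite (bigD1 (Ordinal hi)) //= [X in _ + X]big1 ?addr0; last first.
  move=> k kiA; apply/eqP; apply: contraNT kiA => nz.
  have [|| _ e] := uniq jA k _ _ nz; rewrite ?leq_ord ?leq_addr //.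
  by apply/eqP/val_inj.
(* The shift could alter this coefficient only through terms of order above [iA] at [t^jA];
   minimality excludes them. *)
rewrite !addKn coef_eshift_top // => i' ii'; apply/eqP.
apply: contraLR ii' => /minA[le1 eq1]; rewrite -leqNgt.
by have [/eq1[->]//|] := eqVneq (b * jA + a * i')%N (b * jA + a * iA)%N; nia.
Qed.

Lemma fcoefD A B i j : fcoef (A + B) i j = fcoef A i j + fcoef B i j.
Proof. by rewrite /fcoef fdoD coefD. Qed.

Lemma fcoefN A i j : fcoef (- A) i j = - fcoef A i j.
Proof. by rewrite /fcoef fdoN coefN. Qed.

Lemma fcoefZ c A i j : fcoef (c *: A) i j = c * fcoef A i j.
Proof. by rewrite /fcoef fdoZ coefZ. Qed.

Lemma fcoef_sum (I : Type) (r : seq I) (Q : pred I) (G : I -> fdo F) i j :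
  fcoef (\sum_(l <- r | Q l) G l) i j = \sum_(l <- r | Q l) fcoef (G l) i j.
Proof.
apply: (big_morph (fun M => fcoef M i j)) => [A B|]; first exact: fcoefD.
by rewrite /fcoef fdo0 coef0.
Qed.

Lemma fcoef_monom k P i j : fcoef (fdo_monom k P) i j = P`_i *+ (j == k).
Proof. by rewrite /fcoef /=; case: eqP => _; rewrite ?coef0. Qed.

Lemma fcoef_inj A B : (forall i j, fcoef A i j = fcoef B i j) -> A = B.
Proof. by move=> AB; apply/fdo_eqP => j; apply/polyP => i; exact: AB. Qed.

Lemma fdo_monomD k P Q : fdo_monom k (P + Q) = fdo_monom k P + fdo_monom k Q.
Proof.
by apply/fdo_eqP => n; rewrite fdoD /=; case: eqP => _; rewrite ?addr0.
Qed.

Lemma fdo_monomZ k c P : fdo_monom k (c *: P) = c *: fdo_monom k P.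
Proof.
by apply/fdo_eqP => n; rewrite fdoZ /=; case: eqP => _; rewrite ?scaler0.
Qed.

Lemma order_le A n : (Defs.order A <= n)%N <-> forall i j, fcoef A i j != 0 -> (i <= n)%N.
Proof.
rewrite /Defs.order; case: ex_minnP => N /asboolP szA minN; split=> [Nn i j Aij|An].
  rewrite -ltnS; apply: (leq_trans _ (leq_trans (szA j) _)); last by rewrite ltnS.
  by rewrite ltnNge; apply: contra Aij => ?; rewrite /fcoef nth_default.
apply: minN; apply/asboolP => j; apply/leq_sizeP => i ni.
apply/eqP; apply: contraTT ni => /An; lia.
Qed.

End Products.

(** * The weight filtration *)

Section Filtration.
Variables (F : fieldType) (p q : nat).
Implicit Types (A B M : fdo F).

(* Order at most [n] and all weights at least [d], in units of [1 / q]. *)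
Definition filt (n d : nat) M : Prop :=
  forall i j, fcoef M i j != 0 -> (i <= n)%N /\ (d + p * i <= q * j)%N.

Lemma filtW n d n' d' M : (n <= n')%N -> (d' <= d)%N -> filt n d M -> filt n' d' M.
Proof. by move=> nn dd fM i j /fM[]; lia. Qed.

Lemma filt0 n d : filt n d 0.
Proof. by move=> i j; rewrite /fcoef fdo0 coef0 eqxx. Qed.

Lemma filt_eq0 n d M : M = 0 -> filt n d M.
Proof. by move->; exact: filt0. Qed.

Lemma filtD n d A B : filt n d A -> filt n d B -> filt n d (A + B).
Proof.
move=> fA fB i j; rewrite fcoefD => AB.
have [A0|/fA//] := eqVneq (fcoef A i j) 0.
by apply: fB; rewrite A0 add0r in AB.
Qed.

Lemma filtN n d A : filt n d A -> filt n d (- A).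
Proof. by move=> fA i j; rewrite fcoefN oppr_eq0; exact: fA. Qed.

Lemma filtB n d A B : filt n d A -> filt n d B -> filt n d (A - B).
Proof. by move=> fA fB; apply: filtD => //; apply: filtN. Qed.

Lemma filtZ n d c A : filt n d A -> filt n d (c *: A).
Proof.
by move=> fA i j; rewrite fcoefZ mulf_eq0 negb_or => /andP[_]; exact: fA.
Qed.

Lemma filt_sum n d (I : Type) (r : seq I) (P : pred I) (G : I -> fdo F) :
  (forall i, P i -> filt n d (G i)) -> filt n d (\sum_(i <- r | P i) G i).
Proof. by move=> fG; apply: big_ind => //; [exact: filt0|exact: filtD]. Qed.

(** The extra terms of a product lose order at an unchanged power of [t], so their weight is at
    least the sum of the two weights. *)
Lemma filtM n d n' d' A B :
  filt n d A -> filt n' d' B -> filt (n + n') (d + d') (A * B).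
Proof.
move=> fA fB i j /fcoefM_neq0[i1 [j1 [i2 [j2 [/fA[? ?] /fB[? ?] ? <-]]]]].
by nia.
Qed.

Lemma filt_monom n d i j :
  (i <= n)%N -> (d + p * i <= q * j)%N -> filt n d (fdo_monom j 'X^i).
Proof.
move=> ? ? i' j'; rewrite fcoef_monom coefXn.
have [->|_] := eqVneq i' i; have [->|_] := eqVneq j' j => //;
  by rewrite ?mul0rn eqxx.
Qed.

End Filtration.

(** * Terms of a fixed weight and the linearised equation *)

Section LeadingTerms.
Variables (F : fieldType) (p q : nat).
Hypotheses (q_gt0 : (0 < q)%N) (cop_pq : coprime p q).
Implicit Types (A B M : fdo F) (r : {poly F}) (lam : F).

Local Notation filt := (@filt F p q).

(** As [p] is invertible modulo [q], the congruence [d + p * i = 0] modulo [q] is solvable with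
    [i < q]; the Bezout coefficient [a] is minus the inverse of [p]. *)
Lemma weight_lattice_point d : exists i j, (i < q)%N /\ (d + p * i = q * j)%N.
Proof.
have [a aq qa] := Bezoutl p q_gt0.
rewrite gcdnC (eqP cop_pq) in qa.
have /dvdnP[j hj] : (q %| d + p * ((a * d) %% q))%N.
  rewrite /dvdn -modnDmr -modnMmr modn_mod modnMmr modnDmr mulnA.
  by rewrite -{1}[d]mul1n -mulnDl -/(dvdn _ _) dvdn_mulr // mulnC.
by exists ((a * d) %% q)%N, j; rewrite ltn_pmod // hj mulnC.
Qed.

(** The line of weight [d] has primitive direction [(q, p)], and [i0 < q] makes [(i0, j0)] its first
    point with [i] nonnegative. This is what makes the terms of weight [d] a module of rank one. *)
Lemma weight_lattice_pointP d i0 j0 i j : (i0 < q)%N ->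
    (d + p * i0 = q * j0)%N -> (d + p * i = q * j)%N ->
  exists s, i = (i0 + q * s)%N /\ j = (j0 + p * s)%N.
Proof.
move=> i0q e0 e; have cop_qp : coprime q p by rewrite coprime_sym.
have [lei|lti] := leqP i0 i; last first.
  have : (q %| p * (i0 - i))%N.
    by apply/dvdnP; exists (j0 - j)%N; rewrite mulnBr mulnBl; lia.
  by rewrite Gauss_dvdr // => /dvdn_leq; lia.
have : (q %| p * (i - i0))%N.
  by apply/dvdnP; exists (j - j0)%N; rewrite mulnBr mulnBl; lia.
rewrite Gauss_dvdr // => /dvdnP[s hs]; exists s; split; first by lia.
apply/eqP; rewrite -(eqn_pmul2l q_gt0) mulnDr mulnCA -e -e0; apply/eqP.
by rewrite -addnA -mulnDr [(q * s)%N]mulnC -hs subnKC.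
Qed.

Definition lead_elem lam : fdo F := fdo_monom p 'X^q - lam%:A.

Lemma filt_lead_elem lam : filt q 0 (lead_elem lam).
Proof.
apply: filtB; first by apply: filt_monom; rewrite // mulnC.
by apply/filtZ/(@filt_monom F p q q 0 0 0); rewrite ?muln0.
Qed.

(** The element with coordinate [r] in the layer generated by [t^j0 eps^i0]: its pseudosymbol is
    [t^j0 xi^i0] times [r] evaluated at [t^p xi^q]. *)
Definition lead_op (i0 j0 : nat) r : fdo F :=
  \sum_(s < size r) r`_s *: fdo_monom (j0 + p * s) 'X^(i0 + q * s).

Lemma lead_opE i0 j0 n r : (size r <= n)%N ->
  lead_op i0 j0 r =
    \sum_(s < n) r`_s *: fdo_monom (j0 + p * s) 'X^(i0 + q * s).
Proof.
move=> szr; pose G s := r`_s *: fdo_monom (j0 + p * s) 'X^(i0 + q * s).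
rewrite /lead_op (big_ord_widen n G szr) big_mkcond; apply: eq_bigr => s _.
by case: ltnP => // ?; rewrite nth_default // scale0r.
Qed.

Lemma lead_opD i0 j0 r r' :
  lead_op i0 j0 (r + r') = lead_op i0 j0 r + lead_op i0 j0 r'.
Proof.
rewrite (lead_opE _ _ (size_polyD _ _)) (lead_opE _ _ (leq_maxl _ (size r'))).
rewrite (lead_opE _ _ (leq_maxr (size r) _)) -big_split /=.
by apply: eq_bigr => s _; rewrite coefD scalerDl.
Qed.

Lemma lead_opZ i0 j0 c r : lead_op i0 j0 (c *: r) = c *: lead_op i0 j0 r.
Proof.
rewrite (lead_opE _ _ (size_scale_leq _ _)) scaler_sumr.
by apply: eq_bigr => s _; rewrite coefZ scalerA.
Qed.

Lemma lead_opMX i0 j0 r : lead_op i0 j0 (r * 'X) =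
  \sum_(s < size r) r`_s *: fdo_monom (j0 + p * s + p) 'X^(i0 + q * s + q).
Proof.
have szr : (size (r * 'X)%R <= (size r).+1)%N.
  by have [->|/size_mulX->//] := eqVneq r 0; rewrite mul0r size_poly0.
rewrite (lead_opE _ _ szr) big_ord_recl coefMX scale0r add0r.
apply: eq_bigr => s _; rewrite coefMX /= /bump add1n !mulnS !addnA.
by rewrite ![(_ + p + _)%N]addnAC ![(_ + q + _)%N]addnAC.
Qed.

Lemma fcoef_lead_op i0 j0 r s :
  fcoef (lead_op i0 j0 r) (i0 + q * s) (j0 + p * s) = r`_s.
Proof.
have szr : (size r <= maxn (size r) s.+1)%N by rewrite leq_maxl.
have sr : (s < maxn (size r) s.+1)%N by rewrite leq_maxr.
rewrite (lead_opE _ _ szr) fcoef_sum (bigD1 (Ordinal sr)) //= big1 ?addr0.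
  by rewrite fcoefZ fcoef_monom eqxx coefXn eqxx mulr1.
move=> l ls; rewrite fcoefZ fcoef_monom coefXn eqn_add2l eqn_pmul2l //.
have -> : (s == l) = false by apply: contraNF ls => /eqP e; apply/eqP/val_inj.
by rewrite mul0rn mulr0.
Qed.

Lemma fcoef_lead_op_neq0 i0 j0 r i j : fcoef (lead_op i0 j0 r) i j != 0 ->
  exists s, [/\ r`_s != 0, i = (i0 + q * s)%N & j = (j0 + p * s)%N].
Proof.
move=> nz; apply: contrapT => no; case/eqP: nz.
rewrite /lead_op fcoef_sum big1 // => s _; rewrite fcoefZ fcoef_monom coefXn.
have [->|rs] := eqVneq r`_s 0; first by rewrite mul0r.
have [ei|] := eqVneq i; have [ej|] := eqVneq j; rewrite ?mulr0n ?mul0rn ?mulr0 //.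
by case: no; exists s.
Qed.

Lemma filt_lead_op n d i0 j0 r : (d + p * i0 = q * j0)%N ->
  (forall s, (s < size r)%N -> (i0 + q * s <= n)%N) -> filt n d (lead_op i0 j0 r).
Proof.
move=> e ub i j /fcoef_lead_op_neq0[s [rs -> ->]].
rewrite ub 1?ltnNge; last by apply: contra rs => ?; rewrite nth_default.
by split=> //; rewrite !mulnDr addnA e mulnCA.
Qed.

(* Moving [eps] past a power of [t] only creates terms of lower order at the
   same power of [t], which have larger weight as soon as the slope is positive. *)
Lemma monomM_lead d i j k l : (0 < p)%N -> (d + p * (i + l) <= q * (j + k))%N ->
  filt (i + l) d.+1
    (fdo_monom j 'X^i * fdo_monom k 'X^l - fdo_monom (j + k) 'X^(i + l)).
Proof.
move=> p_gt0 wd i' j'; rewrite fdo_monomM fcoefD fcoefN !fcoef_monom.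
have [->|_] := eqVneq j' (j + k)%N; last by rewrite !mulr0n subr0 eqxx.
rewrite !mulr1n exprD !coefMXn; case: ltnP => li'; first by rewrite subr0 eqxx.
have [il|il] := leqP i (i' - l)%N; last by move=> _; nia.
rewrite coef_eshift_top ?subrr ?eqxx // => i2 ?.
by rewrite coefXn; case: eqP => //; lia.
Qed.

(* For slope zero, [eps - lam] acts on the left of [t^d] as [eps + d - lam]. *)
Definition shifted_root (d : nat) lam := if p == 0%N then lam - d%:R else lam.

(** For positive slope the monomials commute up to larger weight. For slope zero, coprimality gives
    [q = 1], so [j = d], and [eps t^d = t^d (eps + d)] makes the identity exact. *)
Lemma lead_elemM_monom d lam i j : (d + p * i = q * j)%N ->
  filt (i + q) d.+1 (lead_elem lam * fdo_monom j 'X^i -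
    (fdo_monom (j + p) 'X^(i + q) - shifted_root d lam *: fdo_monom j 'X^i)).
Proof.
move=> e; rewrite /lead_elem mulrBl -scalerAl mul1r /shifted_root.
have [p0|p_neq0] := eqVneq p 0%N.
  have q1 : q = 1%N by apply/eqP; move: cop_pq; rewrite p0 /coprime gcd0n.
  have -> : j = d by move: e; rewrite p0 q1; lia.
  rewrite p0 q1 fdo_monomM expr1 /eshift comp_polyX mulrDl -exprS mul_polyC.
  rewrite fdo_monomD fdo_monomZ add0n addn0 addn1 scalerBl opprB.
  by apply/filt_eq0/eqP; rewrite addr_eq0 !opprB addrA addrAC.
have p_gt0 : (0 < p)%N by rewrite lt0n.
rewrite opprB addrA subrK.
by rewrite [(j + p)%N]addnC [(i + q)%N]addnC; apply: monomM_lead => //; nia.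
Qed.

Lemma lead_elemM_lead_op d i0 j0 lam r n : (d + p * i0 = q * j0)%N ->
    (size r <= n)%N ->
  filt (i0 + q * n) d.+1 (lead_elem lam * lead_op i0 j0 r -
    lead_op i0 j0 (r * ('X - (shifted_root d lam)%:P))).
Proof.
move=> e szr; rewrite mulrBr lead_opD [r * _%:P]mulrC mul_polyC -scaleNr lead_opZ.
rewrite lead_opMX /lead_op mulr_sumr scaler_sumr -big_split /= -sumrB.
apply: filt_sum => s _; rewrite -scalerAr scalerA mulrC -scalerA -scalerDr -scalerBr scaleNr.
apply: filtZ; apply: (@filtW _ _ _ (i0 + q * s + q) d.+1) => //; last first.
  by apply: lead_elemM_monom; nia.
by rewrite -addnA leq_add2l -mulnSr leq_mul2l (leq_trans _ szr) ?orbT.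
Qed.

(** For slope zero [i0] vanishes and there is no error. Otherwise [i0 < q] keeps the order
    [i0 + q * s] of each term below [q * n]. *)
Lemma monomM_lead_op d i0 j0 r n : (i0 < q)%N -> (d + p * i0 = q * j0)%N ->
    (size r <= n)%N ->
  filt (q * n) d.+1 (fdo_monom j0 'X^i0 * lead_op 0 0 r - lead_op i0 j0 r).
Proof.
move=> i0q e szr; rewrite /lead_op mulr_sumr -sumrB; apply: filt_sum => s _.
rewrite -scalerAr -scalerBr; apply: filtZ; rewrite !add0n.
have [p0|p_neq0] := eqVneq p 0%N.
  have q1 : q = 1%N by apply/eqP; move: cop_pq; rewrite p0 /coprime gcd0n.
  have -> : i0 = 0%N by lia.
  by rewrite p0 fdo_monomM !mul0n eshift0 -exprD subrr; exact: filt0.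
apply: (@filtW _ _ _ (i0 + q * s) d.+1) => //; last first.
  by apply: monomM_lead; nia.
have sn : (s < n)%N by apply: leq_trans szr.
by rewrite (@leq_trans (q * s.+1)) ?leq_mul2l ?sn ?orbT // mulnS leq_add2r ltnW.
Qed.

Definition lead_coefs i0 j0 n A : {poly F} :=
  \poly_(s < n) fcoef A (i0 + q * s) (j0 + p * s).

(** Only terms of weight exactly [d] have to be cancelled, and they all lie on the lattice line
    through [(i0, j0)]; the condition on [n] puts the cutoff of [lead_coefs] beyond the order
    [q * m]. *)
Lemma filt_sub_lead d i0 j0 n m A : (i0 < q)%N -> (d + p * i0 = q * j0)%N ->
    (q * m < i0 + q * n)%N -> filt (q * m) d A ->
  filt (q * m) d.+1 (A - lead_op i0 j0 (lead_coefs i0 j0 n A)).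
Proof.
move=> i0q e mn fA i j; rewrite fcoefD fcoefN.
have [A0|Anz] := eqVneq (fcoef A i j) 0.
  rewrite A0 add0r oppr_eq0 => /fcoef_lead_op_neq0[s [+ ei ej]].
  by rewrite coef_poly -ei -ej A0 if_same eqxx.
have [im wj] := fA _ _ Anz; have [eij|] := eqVneq (d + p * i)%N (q * j)%N; last by lia.
have [s [ei ej]] := weight_lattice_pointP i0q e eij.
rewrite ei ej fcoef_lead_op coef_poly -ei -ej ifT ?subrr ?eqxx //.
by move: im mn; rewrite ei; nia.
Qed.

(* Evaluating at the (shifted) root of the left factor solves the linearised
   factorisation: the remainder modulo that factor is absorbed by [b]. *)
Lemma linear_step d m lam (B0 : {poly F}) R : size B0 = m.+1 ->
    B0.[shifted_root d lam] != 0 -> filt (q * m.+1) d R ->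
  exists a b, [/\ filt q d a, filt (q * m) d b &
    filt (q * m.+1) d.+1 (R - (lead_elem lam * b + a * lead_op 0 0 B0))].
Proof.
move=> szB nzB fR; have [i0 [j0 [i0q e]]] := weight_lattice_point d.
set c := shifted_root d lam in nzB *.
(* [n] counts the points of weight [d] and order at most [q * m], that is, the coefficients
   available to [b]. The remainder [R], of order at most [q * m.+1], has one more, which the
   division by ['X - c%:P] removes; [alpha] makes that division exact. *)
pose n := (m.+1 - (0 < i0))%N.
pose r := lead_coefs i0 j0 n.+1 R; pose alpha := r.[c] / B0.[c].
have : root (r - alpha *: B0) c.
  by rewrite /root !hornerE divfK // subrr.
case/factor_theorem => g hg.
have szg : (size g <= n)%N.
  have [->|g0] := eqVneq g 0; first by rewrite size_poly0.
  have : size (g * ('X - c%:P)) = (size g).+1.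
    by rewrite size_Mmonic ?monicXsubC // size_XsubC addn2.
  rewrite -hg -ltnS => <-; rewrite (leq_trans (size_polyD _ _)) // geq_max.
  rewrite size_poly size_polyN (leq_trans (size_scale_leq _ _)) // szB /n.
  by case: (0 < i0)%N; lia.
have hr : lead_op i0 j0 r =
    lead_op i0 j0 (g * ('X - c%:P)) + alpha *: lead_op i0 j0 B0.
  by rewrite -lead_opZ -lead_opD -hg subrK.
exists (alpha *: fdo_monom j0 'X^i0), (lead_op i0 j0 g); split.
- by apply/filtZ/filt_monom; lia.
- apply: filt_lead_op => // s sg; have := leq_trans sg szg; rewrite /n.
  have [->|i0_gt0] := posnP i0; first by rewrite leq_mul2l subn0 ltnS orbC => ->.
  rewrite subn1 /= => sm; apply: (@leq_trans (q * s.+1)); last by rewrite leq_mul2l sm orbT.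
  by rewrite mulnS leq_add2r ltnW.
have -> : R - (lead_elem lam * lead_op i0 j0 g +
      alpha *: fdo_monom j0 'X^i0 * lead_op 0 0 B0) =
    (R - lead_op i0 j0 r) - (lead_elem lam * lead_op i0 j0 g -
      lead_op i0 j0 (g * ('X - c%:P))) -
    alpha *: (fdo_monom j0 'X^i0 * lead_op 0 0 B0 - lead_op i0 j0 B0).
  rewrite hr scalerBr -scalerAl -!addrA -!opprD; congr (R - _).
  by rewrite addrACA !subrKC.
apply: filtB; first apply: filtB.
- apply: filt_sub_lead => //; rewrite /n; have [->|i0_gt0] := posnP i0.
    by rewrite subn0 add0n ltn_mul2l q_gt0 ltnSn.
  by rewrite subn1 /= -[X in (X < _)%N]add0n ltn_add2r.
- apply: (filtW _ _ (lead_elemM_lead_op e szg)) => //.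
  rewrite /n; have [->|i0_gt0] := posnP i0; first by rewrite subn0.
  by rewrite subn1 /= mulnS leq_add2r ltnW.
- by apply/filtZ/monomM_lead_op => //; rewrite szB.
Qed.
End LeadingTerms.

(** * Splitting off a left factor by successive approximation *)

Section Factorization.
Variables (F : fieldType) (p q : nat).
Hypotheses (q_gt0 : (0 < q)%N) (cop_pq : coprime p q).
Implicit Types (A B M L : fdo F) (lam : F).

Local Notation filt := (@filt F p q).

Lemma filt_eq_zero n M : (forall d, filt n d M) -> M = 0.
Proof.
move=> fM; apply: fcoef_inj => i j; rewrite [RHS]/fcoef fdo0 coef0.
by apply/eqP; apply: contraT => /(fM (q * j).+1)[]; lia.
Qed.

(* The coefficient of [t^j] is stationary from step [q * j] on. *)
Lemma filt_limit n (S : nat -> fdo F) :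
  (forall d, filt n d.+1 (S d.+1 - S d)) -> exists A, forall d, filt n d.+1 (A - S d).
Proof.
move=> stepS.
have cauchyS d e : filt n d.+1 (S (d + e)%N - S d).
  elim: e => [|e IHe]; first by rewrite addn0 subrr; apply: filt0.
  rewrite addnS -(subrK (S (d + e)%N) (S _)) -addrA; apply: filtD => //.
  by apply: (filtW _ _ (stepS _)) => //; lia.
have stat j d : (q * j <= d)%N -> S d j = S (q * j)%N j.
  move=> jd; apply/polyP => i; apply/eqP; rewrite -subr_eq0.
  have := cauchyS (q * j)%N (d - q * j)%N i j; rewrite subnKC // fcoefD fcoefN.
  by rewrite /fcoef; case: eqP => // _ /(_ isT)[]; lia.
(* All the [S d] differ from [S 0] by operators of order at most [n], so the diagonal sequence
   inherits a uniform degree bound. *)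
have bndA : (fun j => S (q * j)%N j) \in @bounded_degree F.
  have /bounded_degreeP[N bN] := fdo_valP (S 0%N).
  apply/bounded_degreeP; exists (maxn n.+1 N) => j.
  rewrite -(subrK (S 0%N j) (S (q * j)%N j)) (leq_trans (size_polyD _ _)) //.
  rewrite geq_max (leq_trans (bN _)) ?leq_maxr // andbT.
  rewrite (leq_trans _ (leq_maxl _ _)) //; apply/leq_sizeP => i ni.
  have := cauchyS 0%N (q * j)%N i j; rewrite add0n fcoefD fcoefN /fcoef coefB.
  by case: eqP => // _ /(_ isT)[]; lia.
exists (Fdo bndA) => d i j; rewrite fcoefD fcoefN /fcoef /=.
rewrite -(@stat j (maxn d (q * j))) ?leq_maxr //.
have := cauchyS d (maxn d (q * j) - d)%N i j.
by rewrite subnKC ?leq_maxl // fcoefD fcoefN.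
Qed.

(** Starting from the leading parts [A0] and [D0], the step at stage [d] corrects a residual of
    weight at least [d + 1]. Corrections thus begin at weight 1, which is why only positive shifts
    of [lam] must avoid the roots of [B0]. *)
Lemma factor_out m lam (B0 : {poly F}) L : size B0 = m.+1 ->
    (forall d, (0 < d)%N -> B0.[shifted_root p d lam] != 0) ->
    filt (q * m.+1) 0 L ->
    (forall s, fcoef L (q * s) (p * s) = (B0 * ('X - lam%:P))`_s) ->
  exists A B, [/\ L = A * B, filt q 1 (A - lead_elem p q lam),
    filt (q * m) 0 B & forall s, fcoef B (q * s) (p * s) = B0`_s].
Proof.
move=> szB nzB fL leadL.
set A0 := lead_elem p q lam; set D0 := lead_op p q 0 0 B0.
have fA0 : filt q 0 A0 by exact: filt_lead_elem.
have fD0 : filt (q * m) 0 D0.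
  apply: filt_lead_op => //; rewrite ?muln0 // => s; rewrite szB ltnS => sm.
  by rewrite add0n leq_mul2l sm orbT.
(* In weight zero the shifted root is [lam] itself for every slope, so [A0 * D0] has the same terms
   of weight zero as [L]. *)
have init : filt (q * m.+1) 1 (L - A0 * D0).
  have szX : size (B0 * ('X - lam%:P)) = m.+2.
    by rewrite size_Mmonic ?monicXsubC -?size_poly_gt0 ?szB // size_XsubC addn2.
  have := @filt_sub_lead F p q q_gt0 cop_pq 0 0 0 m.+2 m.+1 L q_gt0.
  have -> : lead_coefs p q 0 0 m.+2 L = B0 * ('X - lam%:P).
    apply/polyP => s; rewrite coef_poly !add0n leadL; case: ltnP => // ?.
    by rewrite nth_default ?szX.
  rewrite !muln0 add0n ltn_mul2l q_gt0 ltnSn => /(_ erefl isT fL) fL1.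
  have := @lead_elemM_lead_op F p q q_gt0 cop_pq 0 0 0 lam B0 m.+1.
  rewrite !muln0 szB => /(_ erefl (leqnn _)).
  rewrite /shifted_root subr0 if_same add0n => /(filtB fL1).
  by rewrite opprB addrA subrK.
(* [f] chooses the corrections for a residual at a given stage; on pairs outside the filtration its
   value is the irrelevant default [(0, 0)]. *)
have [f fP] : {f : nat * fdo F -> fdo F * fdo F & forall x,
    filt (q * m.+1) x.1.+1 x.2 -> [/\ filt q x.1.+1 (f x).1,
      filt (q * m) x.1.+1 (f x).2 & filt (q * m.+1) x.1.+2
        (x.2 - (A0 * (f x).2 + (f x).1 * D0))]}.
  apply: (@choice _ _ (fun x ab => filt (q * m.+1) x.1.+1 x.2 ->
    [/\ filt q x.1.+1 ab.1, filt (q * m) x.1.+1 ab.2 &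
      filt (q * m.+1) x.1.+2 (x.2 - (A0 * ab.2 + ab.1 * D0))])).
  move=> [d M] /=; have [fM|nfM] := pselect (filt (q * m.+1) d.+1 M); last first.
    by exists (0, 0).
  have [a [b fab]] := linear_step q_gt0 cop_pq szB (nzB d.+1 isT) fM.
  by exists (a, b).
pose step d (S : fdo F * fdo F) :=
  (S.1 + (f (d, L - S.1 * S.2)).1, S.2 + (f (d, L - S.1 * S.2)).2).
pose S d := iteri d step (A0, D0).
have S1 d : (S d.+1).1 - (S d).1 = (f (d, L - (S d).1 * (S d).2)).1.
  by rewrite /S /= addrC addKr.
have S2 d : (S d.+1).2 - (S d).2 = (f (d, L - (S d).1 * (S d).2)).2.
  by rewrite /S /= addrC addKr.
have SP d : [/\ filt q 1 ((S d).1 - A0), filt (q * m) 1 ((S d).2 - D0) &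
    filt (q * m.+1) d.+1 (L - (S d).1 * (S d).2)].
  elim: d => [|d [fS1 fS2 fS]]; first by rewrite !subrr; split=> //; exact: filt0.
  have [] := fP (d, _) fS; rewrite -S1 -S2.
  pose a := (S d.+1).1 - (S d).1; pose b := (S d.+1).2 - (S d).2.
  rewrite -/a -/b => fa fb fab.
  have e1 : (S d.+1).1 = a + (S d).1 by rewrite subrK.
  have e2 : (S d.+1).2 = b + (S d).2 by rewrite subrK.
  clearbody a b; rewrite {}e1 {}e2.
  move: (S d).1 (S d).2 fS1 fS2 fS fab => A B fS1 fS2 fS fab.
  split.
  - by rewrite -addrA; apply: filtD fS1; apply: filtW fa.
  - by rewrite -addrA; apply: filtD fS2; apply: filtW fb.
  (* The residual left by the linearised equation, minus the errors of replacing [A] and [B] by [A0]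
     and [D0] and the quadratic term. Each error gains at least one unit over [d.+1]. *)
  rewrite (_ : _ - _ = L - A * B - (A0 * b + a * D0) -
    ((A - A0) * b + a * (B - D0) + a * b)).
    apply: filtB => //; rewrite mulnS.
    do ?apply: filtD.
    + exact: filtM fS1 fb.
    + by rewrite -[d.+2]addn1; apply: filtM fa fS2.
    + by apply: (filtW _ _ (filtM fa fb)) => //; rewrite /= addnS ltnS leq_addr.
  have subr3 (x y z w : fdo F) : x - y - z - w = x - (y + (z + w)).
    by rewrite !opprD !addrA.
  rewrite subr3; congr (L - _).
  rewrite [(A - A0) * b]mulrBl [a * (B - D0)]mulrBr.
  rewrite [X in _ = _ + X]addrA [X in _ = _ + (X + _)]addrACA !subrKC.
  rewrite mulrDl !mulrDr [LHS]addrC [A * b + A * B]addrC [a * b + a * B]addrC.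
  by rewrite -!addrA.
have [A limA] : exists A, forall d, filt q d.+1 (A - (S d).1).
  apply: (@filt_limit _ (fun d => (S d).1)) => d; rewrite S1.
  by have [_ _ /(fP (d, _))[]] := SP d.
have [B limB] : exists B, forall d, filt (q * m) d.+1 (B - (S d).2).
  apply: (@filt_limit _ (fun d => (S d).2)) => d; rewrite S2.
  by have [_ _ /(fP (d, _))[]] := SP d.
exists A, B; split.
(* For every [d] the difference of [L] and [A * B] is the residual of stage [d] plus two truncation
   errors, all of weight at least [d + 1]; hence it vanishes. *)
- apply/eqP; rewrite -subr_eq0; apply/eqP.
  apply: (@filt_eq_zero (q * m.+1)) => d; apply: (@filtW _ _ _ (q * m.+1) d.+1) => //.
  have [fS1 fS2 fS] := SP d.
  rewrite (_ : _ - _ = L - (S d).1 * (S d).2 - (A - (S d).1) * (S d).2 -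
    A * (B - (S d).2)); last first.
    rewrite mulrBl mulrBr -!addrA -!opprD; congr (L - _).
    by rewrite addrA !subrKC.
  rewrite mulnS; do 2?apply: filtB.
  + by rewrite -mulnS.
  + rewrite -[d.+1]addn0; apply: filtM => //.
    by rewrite -(subrK D0 (S d).2); apply: filtD => //; apply: filtW fS2.
  + rewrite -[d.+1]add0n; apply: filtM => //.
    by rewrite -(subrK A0 A); apply: filtD => //; apply: filtW (limA 0%N).
- exact: limA 0%N.
- by rewrite -(subrK D0 B); apply: filtD => //; apply: filtW (limB 0%N).
(* [B - D0] has only terms of positive weight, while the points [(q * s, p * s)] have weight
   zero. *)
- move=> s; have := limB 0%N (q * s)%N (p * s)%N; rewrite fcoefD fcoefN.
  have := @fcoef_lead_op F p q q_gt0 0 0 B0 s; rewrite !add0n => ->.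
  by rewrite subr_eq0; case: eqP => // _ /(_ isT)[]; rewrite mulnCA; lia.
Qed.
End Factorization.

(** * Complete factorisation *)

Section Chains.
Variables (F : fieldType) (p q : nat).
Hypotheses (q_gt0 : (0 < q)%N) (cop_pq : coprime p q).
Implicit Types (A B M L : fdo F) (lam : nat -> F).

Local Notation filt := (@filt F p q).

Lemma lead_op_XsubC (c : F) : lead_op p q 0 0 ('X - c%:P) = lead_elem p q c.
Proof.
rewrite (@lead_opE _ _ _ _ _ 2) ?size_XsubC // !big_ord_recl big_ord0 /= addr0.
rewrite !coefB !coefX !coefC /= sub0r subr0 scale1r !add0n !muln0 !muln1.
by rewrite scaleNr addrC.
Qed.

(** Induction, splitting off the leftmost factor. Its complement carries the later roots, so
    nonresonance is required only for [i < j]; the last operator that remains is itself a factor. *)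
Lemma factor_chain m lam L :
    (forall i j d, (i < j <= m)%N -> (0 < d)%N -> shifted_root p d (lam i) != lam j) ->
    filt (q * m.+1) 0 L ->
    (forall s, fcoef L (q * s) (p * s) = (\prod_(j < m.+1) ('X - (lam j)%:P))`_s) ->
  exists Lf : nat -> fdo F, L = \prod_(j < m.+1) Lf j /\
    forall j, (j <= m)%N -> filt q 1 (Lf j - lead_elem p q (lam j)).
Proof.
elim: m lam L => [|m IHm] lam L nores fL leadL.
  exists (fun=> L); split=> [|j]; first by rewrite big_ord1.
  rewrite leqn0 => /eqP->; rewrite big_ord1 in leadL.
  have := @filt_sub_lead F p q q_gt0 cop_pq 0 0 0 2 1 L q_gt0.
  have -> : lead_coefs p q 0 0 2 L = 'X - (lam 0%N)%:P.
    apply/polyP => s; rewrite coef_poly !add0n leadL; case: ltnP => // ?.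
    by rewrite nth_default ?size_XsubC.
  rewrite lead_op_XsubC !muln0 add0n ltn_mul2l q_gt0 muln1 in fL *.
  by move=> /(_ erefl isT fL).
pose B0 : {poly F} := \prod_(j < m.+1) ('X - (lam j.+1)%:P).
have szB : size B0 = m.+2.
  rewrite /B0 -(big_mkord xpredT (fun j => 'X - (lam j.+1)%:P)).
  by rewrite size_prod_XsubC size_iota subn0.
have nzB d : (0 < d)%N -> B0.[shifted_root p d (lam 0%N)] != 0.
  move=> d_gt0; rewrite horner_prod; apply/prodf_neq0 => j _.
  by rewrite hornerXsubC subr_eq0; apply: nores => //=; rewrite ltn_ord.
have [|A [B [-> fA fB leadB]]] := factor_out q_gt0 cop_pq szB nzB fL.
  by move=> s; rewrite leadL big_ord_recl mulrC.
have [|Lf [-> fLf]] := IHm (fun j => lam j.+1) B _ fB leadB.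
  by move=> i j d ij; apply: nores.
exists (fun j => if j is k.+1 then Lf k else A); split.
  by rewrite [RHS]big_ord_recl.
by case=> [|j] //; rewrite ltnS; apply: fLf.
Qed.

End Chains.

(** * Irreducibility of the factors *)

Section Irreducibility.
Variable F : fieldType.
Implicit Types (A B M : fdo F).

Lemma order_top_coef A : A != 0 -> exists j, fcoef A (Defs.order A) j != 0 /\
  forall j', fcoef A (Defs.order A) j' != 0 -> (j <= j')%N.
Proof.
move=> A_neq0; have ubA := (order_le A _).1 (leqnn (Defs.order A)).
have exA : exists j, fcoef A (Defs.order A) j != 0.
  (* Order zero is treated apart: it is also the conventional order of the zero operator, so here
     nonvanishing of [A] is used. *)
  apply: contrapT => no; case eA : (Defs.order A) => [|n].
    case/eqP: A_neq0; apply: fcoef_inj => i j; rewrite [RHS]/fcoef fdo0 coef0.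
    apply/eqP; apply: contraT => nz; case: no; exists j.
    by have := ubA _ _ nz; rewrite eA leqn0 => /eqP <-.
  have : (Defs.order A <= n)%N.
    apply/order_le => i j nz; have := ubA _ _ nz; rewrite eA leq_eqVlt ltnS.
    by case/orP=> // /eqP ei; case: no; exists j; rewrite eA -ei.
  by rewrite eA ltnn.
by case: (ex_minnP exA) => j nz minj; exists j.
Qed.

Lemma leq_orderM A B : A != 0 -> B != 0 ->
  (Defs.order A + Defs.order B <= Defs.order (A * B)%R)%N.
Proof.
move=> /order_top_coef[jA [nzA minA]] /order_top_coef[jB [nzB minB]].
have ub (C : fdo F) := (order_le C _).1 (leqnn (Defs.order C)).
apply: (ub (A * B) _ (jA + jB)%N).
(* The coefficient [jA + jB + 1] of the order exceeds [jA] and [jB], so losing one order outweighs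
   any saving in powers of [t]: the minimum is attained only at the top-order term with least power
   of [t]. *)
rewrite (@fcoefM_extremal F (jA + jB).+1 1) ?mulf_neq0 // => i j nz.
  have := ub _ _ _ nz; rewrite leq_eqVlt => /orP[/eqP ei|lt].
    by rewrite ei in nz *; have := minA _ nz; lia.
  have : ((jA + jB).+1 * i.+1 <= (jA + jB).+1 * Defs.order A)%N by rewrite leq_mul2l.
  by rewrite mulnS; lia.
have := ub _ _ _ nz; rewrite leq_eqVlt => /orP[/eqP ei|lt].
  by rewrite ei in nz *; have := minB _ nz; lia.
have : ((jA + jB).+1 * i.+1 <= (jA + jB).+1 * Defs.order B)%N by rewrite leq_mul2l.
by rewrite mulnS; lia.
Qed.

(* Perturbing the weight by less than one unit makes the minimiser unique: it
   is the term of largest order among those of minimal weight. *)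
Lemma min_weight_term p q n A : (0 < q)%N -> A != 0 ->
    (forall i j, fcoef A i j != 0 -> (i <= n)%N) ->
  exists iA jA, fcoef A iA jA != 0 /\ forall i j, fcoef A i j != 0 ->
    (n.+1 * q * jA + (n.+1 * p).+1 * i <= n.+1 * q * j + (n.+1 * p).+1 * iA)%N /\
    ((n.+1 * q * jA + (n.+1 * p).+1 * i = n.+1 * q * j + (n.+1 * p).+1 * iA)%N ->
      i = iA /\ j = jA).
Proof.
move=> q_gt0 A_neq0 ubA; set a := (n.+1 * p).+1.
(* The perturbed form [n.+1 * (q * j - p * i) - i], raised by the constant [a * n] to stay in the
   natural numbers. *)
pose v i j := (n.+1 * q * j + a * (n - i))%N.
have exv : exists k, `[< exists i j, fcoef A i j != 0 /\ v i j = k >].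
  have [j [nz _]] := order_top_coef A_neq0.
  by exists (v (Defs.order A) j); apply/asboolP; exists (Defs.order A), j.
case: (ex_minnP exv) => k /asboolP[iA [jA [nzA vk]]] mink.
exists iA, jA; split=> // i j nz; have iAn := ubA _ _ nzA; have i_n := ubA _ _ nz.
have : (k <= v i j)%N by apply: mink; apply/asboolP; exists i, j.
have vE i' j' : (i' <= n)%N -> (v i' j' + a * i' = n.+1 * q * j' + a * n)%N.
  by move=> ?; rewrite /v -addnA -mulnDr subnK.
have eA := vE _ jA iAn; have e := vE _ j i_n.
rewrite -vk => lev; split; first by lia.
move=> eq.
have {}eq : (n.+1 * (q * jA + p * i) + i = n.+1 * (q * j + p * iA) + iA)%N.
  by move: eq; rewrite /a !mulSnr !mulnDr !mulnA; lia.
(* Both orders are at most [n], so reduction modulo [n.+1] recovers them. *)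
have ei : i = iA.
  have := congr1 (modn^~ n.+1) eq.
  by rewrite ![(n.+1 * _)%N]mulnC !modnMDl !modn_small ?ltnS.
split=> //; move: eq; rewrite ei => /addIn /eqP.
by rewrite eqn_pmul2l // => /eqP/addIn/eqP; rewrite eqn_pmul2l // => /eqP.
Qed.

Lemma fcoef_lead_elem p q (c : F) i j : fcoef (lead_elem p q c) i j =
  ((i == q) && (j == p))%:R - c * ((i == 0%N) && (j == 0%N))%:R.
Proof.
rewrite fcoefD fcoefN fcoefZ (fcoef_monom p) (fcoef_monom 0 1) coefXn coef1.
by case: (i == q); case: (j == p); case: (i == 0%N); case: (j == 0%N).
Qed.

Lemma elem_top_coef p q (c : F) M : (0 < q)%N ->
  filt p q q 1 (M - lead_elem p q c) -> fcoef M q p = 1.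
Proof.
move=> q_gt0 fM; apply/eqP; rewrite -subr_eq0.
have -> : 1 = fcoef (lead_elem p q c) q p.
  by rewrite fcoef_lead_elem !eqxx (gtn_eqF q_gt0) mulr0 subr0.
by rewrite -fcoefN -fcoefD; apply: contraT => /fM[]; rewrite mulnC; lia.
Qed.

Lemma elem_irreducible p q (lam : F) M : (0 < q)%N -> coprime p q -> lam != 0 ->
  filt p q q 1 (M - lead_elem p q lam) -> irreducible_op M.
Proof.
move=> q_gt0 cop_pq lam_neq0 fM A B MAB [oA oB].
have fE : filt p q q 0 (lead_elem p q lam) := @filt_lead_elem _ p q lam.
have fM0 : filt p q q 0 M.
  by rewrite -(subrK (lead_elem p q lam) M); apply: filtD => //; apply: filtW fM.
have M00 : fcoef M 0 0 = - lam.
  apply/eqP; rewrite -subr_eq0.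
  have -> : - lam = fcoef (lead_elem p q lam) 0 0.
    by rewrite fcoef_lead_elem (ltn_eqF q_gt0) mulr1 sub0r.
  by rewrite -fcoefN -fcoefD; apply: contraT => /fM[]; rewrite !muln0.
have A00B00 : fcoef A 0 0 * fcoef B 0 0 != 0.
  have := M00; rewrite MAB fcoefM !big_ord1 /= eshift0 => ->.
  by rewrite oppr_eq0.
move: A00B00; rewrite mulf_eq0 negb_or => /andP[A00 B00].
have neq0 (C : fdo F) : fcoef C 0 0 != 0 -> C != 0.
  by apply: contraNN => /eqP->; rewrite /fcoef fdo0 coef0.
have oAB : (Defs.order A + Defs.order B <= q)%N.
  apply: leq_trans (leq_orderM (neq0 _ A00) (neq0 _ B00)) _.
  by rewrite -MAB; apply/order_le => i j /fM0[].
have ub (C : fdo F) := (order_le C _).1 (leqnn (Defs.order C)).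
have ubq (C : fdo F) : (Defs.order C <= q)%N -> forall i j, fcoef C i j != 0 -> (i <= q)%N.
  by move=> Cq i j /ub; lia.
have [iA [jA [nzA minA]]] := @min_weight_term p q q A q_gt0 (neq0 _ A00) (ubq A ltac:(lia)).
have [iB [jB [nzB minB]]] := @min_weight_term p q q B q_gt0 (neq0 _ B00) (ubq B ltac:(lia)).
(* The perturbation is at most [q], less than the unit [q.+1], so a minimiser of the perturbed form
   also minimises the integral weight. *)
have wmin i j iC jC : (i <= q)%N -> (iC <= q)%N ->
  (q.+1 * q * jC + (q.+1 * p).+1 * i <= q.+1 * q * j + (q.+1 * p).+1 * iC)%N ->
  (q * jC + p * i <= q * j + p * iC)%N.
  move=> iq iCq le; rewrite -ltnS -(ltn_pmul2l (ltn0Sn q)).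
  by rewrite mulnS !mulnDr !mulnA; move: le; rewrite !mulSnr; lia.
have iAq : (iA <= q)%N by have := ub _ _ _ nzA; lia.
have iBq : (iB <= q)%N by have := ub _ _ _ nzB; lia.
have wA i j : fcoef A i j != 0 -> (q * jA + p * i <= q * j + p * iA)%N.
  move=> nz; apply: wmin (minA _ _ nz).1 => //.
  by have := ub _ _ _ nz; lia.
have wB i j : fcoef B i j != 0 -> (q * jB + p * i <= q * j + p * iB)%N.
  move=> nz; apply: wmin (minB _ _ nz).1 => //.
  by have := ub _ _ _ nz; lia.
have wM : (p * (iA + iB) <= q * (jA + jB))%N.
  have : fcoef M (iA + iB) (jA + jB) != 0.
    by rewrite MAB (fcoefM_extremal minA minB) mulf_neq0.
  by case/fM0.
have := wA _ _ A00; have := wB _ _ B00; rewrite !muln0 !addn0 !add0n => w0B w0A.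
rewrite !mulnDr in wM.
have : fcoef M q p != 0 by rewrite (elem_top_coef q_gt0 fM) oner_eq0.
rewrite MAB => /fcoefM_neq0[i1 [j1 [i2 [j2 [nz1 nz2 qi jp]]]]].
have := wA _ _ nz1; have := wB _ _ nz2; have := ub _ _ _ nz1; have := ub _ _ _ nz2.
move=> u2 u1 w2 w1.
(* [q <= i1 + i2], while the orders of [A] and [B] sum to at most [q]: both terms have top order. *)
have i1E : i1 = Defs.order A by lia.
have i2E : i2 = Defs.order B by lia.
have eq_pq : (p * i1 + p * i2 = q * j1 + q * j2)%N.
  by rewrite -!mulnDr jp mulnC; congr (_ * _)%N; lia.
(* Both minimal weights are zero, so the two weights here are nonnegative; their sum is zero. *)
have e1 : (p * i1 = q * j1)%N by lia.
have : (q %| p * i1)%N by rewrite e1 dvdn_mulr.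
by rewrite Gauss_dvdr 1?coprime_sym // => /dvdn_leq; lia.
Qed.

End Irreducibility.

(** * Newton polygons with one slope *)

Section Slopes.
Variable R : realType.
Implicit Types (D : set (R^o * R^o)) (A L : fdo R[i]).

Lemma closed_half_plane (a b c : R) :
  closed [set z : R^o * R^o | a * z.1 + c <= b * z.2].
Proof.
have cf : continuous (fun z : R^o * R^o => b * z.2 - (a * z.1 + c) : R^o).
  move=> z; apply: cvgB; first by apply: cvgM; [exact: cvg_cst|exact: cvg_snd].
  apply: cvgD; last exact: cvg_cst.
  by apply: cvgM; [exact: cvg_cst|exact: cvg_fst].
have /continuous_closedP/(_ _ (@closed_ge R 0)) := cf.
by congr closed; apply/seteqP; split=> z /=; rewrite subr_ge0.
Qed.

Lemma convex_half_plane (a b c : R) :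
  convex_set ([set z | a * z.1 + c <= b * z.2] :
    set (convex_lmodType (R^o * R^o)%type)).
Proof.
move=> x y l; rewrite !inE /= => xD yD.
have l0 : 0 <= l%:num :> R by []. have l1 : l%:num <= 1 :> R by [].
rewrite -subr_ge0 in xD yD; rewrite -subr_ge0.
have -> : b * (l%:num * x.2 + (1 - l%:num) * y.2) -
    (a * (l%:num * x.1 + (1 - l%:num) * y.1) + c) =
    l%:num * (b * x.2 - (a * x.1 + c)) +
    (1 - l%:num) * (b * y.2 - (a * y.1 + c)) by ring.
by rewrite addr_ge0 // mulr_ge0 // subr_ge0.
Qed.

Lemma convex_comb D (u v : R^o * R^o) (s : R) :
    convex_set (D : set (convex_lmodType (R^o * R^o)%type)) ->
    0 <= s <= 1 -> D u -> D v ->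
  D (s * u.1 + (1 - s) * v.1, s * u.2 + (1 - s) * v.2).
Proof.
move=> cD /andP[s0 s1] Du Dv.
have := cD u v (Itv01 s0 s1); rewrite !inE => /(_ Du Dv).
by case: u v Du Dv => [? ?] [? ?].
Qed.

Lemma convex_setI (D D' : set (convex_lmodType (R^o * R^o)%type)) :
  convex_set D -> convex_set D' -> convex_set (D `&` D').
Proof.
move=> cD cD' x y l; rewrite !inE => -[Dx D'x] [Dy D'y].
by split; apply/set_mem; [apply: cD|apply: cD']; rewrite inE.
Qed.

Lemma ratr_slope (p q : nat) : ratr (p%:R / q%:R) = p%:R / q%:R :> R.
Proof. by rewrite rmorphM fmorphV !rmorph_nat. Qed.

(** If the support missed the right end of the lower edge, a slightly steeper half-plane would
    contain the origin and the support but not that vertex, against the minimality of the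
    polygon. *)
Lemma newton_polygon_vertex (p q : nat) L : (0 < q)%N ->
    single_slope L (p%:R / q%:R) ->
  (forall i j, fcoef L i j != 0 -> (p * i <= q * j)%N) /\
  exists j, fcoef L (Defs.order L) j != 0 /\ (p * Defs.order L = q * j)%N.
Proof.
move=> q_gt0 [n_gt0 _ polyL]; set n := Defs.order L in n_gt0 polyL *.
have q_gt0R : 0 < q%:R :> R by rewrite ltr0n.
have wL i j : fcoef L i j != 0 -> (p * i <= q * j)%N.
  move=> nz; have : newton_polygon L (i%:R, j%:R).
    by apply: sub_gen_smallest; right; exists (i, j).
  rewrite polyL /= ratr_slope => -[_].
  by rewrite mulrAC ler_pdivrMr // -!natrM ler_nat [(j * q)%N]mulnC.
split=> //; apply: contrapT => no.
(* This bound follows from [p * i <= q * j] when [i < n], and at [i = n] asks for strict inequality.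
   It admits the origin because [n] is positive. *)
pose D : set (R^o * R^o) :=
  [set z | (p%:R + 1) * z.1 + (1 - n%:R) <= q%:R * z.2].
have : newton_polygon L (n%:R, ratr (p%:R / q%:R) * n%:R).
  by rewrite polyL /= lexx ler0n.
have subD : newton_polygon L `<=` D.
  apply: smallest_sub.
    split; [exact: closed_half_plane|exact: convex_half_plane|].
    by move=> x y; rewrite /D /= => ?; rewrite mulrDr ler_wpDr ?mulr_ge0 ?ler0n.
  move=> z [->|[[i j] nz <-]] /=.
    by rewrite /D /= !mulr0 add0r subr_le0 ler1n.
  rewrite /D /= mulrDl mul1r addrA lerBlDr -!natrM -!natrD natr1 ler_nat.
  have := wL i j nz; have := (order_le L n).1 (leqnn _) i j nz.
  rewrite leq_eqVlt => /orP[/eqP ei|]; last by lia.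
  rewrite leq_eqVlt => /orP[/eqP e|]; last by lia.
  by case: no; exists j; rewrite -/n -ei.
move/subD; rewrite /D /= ratr_slope.
by rewrite mulrA [q%:R * _]mulrC divfK ?gt_eqF // mulrDl mul1r addrA lerBlDr gerDl ler10.
Qed.

(** The strip is an intersection of three half-planes, which gives one inclusion. Conversely the
    segment from the origin to [(n, k)], translated upwards, fills it by convexity. *)
Lemma single_slope_intro (p q n k : nat) A : (0 < q)%N -> (0 < n)%N ->
    (p * n = q * k)%N -> Defs.order A = n -> fcoef A n k != 0 ->
    (forall i j, fcoef A i j != 0 -> (p * i <= q * j)%N) ->
  single_slope A (p%:R / q%:R).
Proof.
move=> q_gt0 n_gt0 pnqk oA nzA wA.
have q_gt0R : 0 < q%:R :> R by rewrite ltr0n.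
have n_gt0R : 0 < n%:R :> R by rewrite ltr0n.
rewrite /single_slope oA; split; [by []|by rewrite divr_ge0 ?ler0n|].
rewrite ratr_slope; set r := _ / _.
have rn : r * n%:R = k%:R.
  by rewrite /r mulrAC -natrM pnqk natrM mulrC mulKf ?gt_eqF.
apply/seteqP; split.
  apply: smallest_sub.
    have -> : [set z : R^o * R^o | 0 <= z.1 <= n%:R /\ r * z.1 <= z.2] =
        [set z | -1 * z.1 + 0 <= 0 * z.2] `&`
        [set z | 1 * z.1 + - n%:R <= 0 * z.2] `&`
        [set z | r * z.1 + 0 <= 1 * z.2].
      apply/seteqP; split=> z /=; rewrite !mul0r !addr0 !mul1r mulN1r oppr_le0 subr_le0.
        by case=> /andP[].
      by case=> [[-> ->] ->].
    split.
    - by do 2?apply: closedI; apply: closed_half_plane.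
    - by do 2?apply: convex_setI; apply: convex_half_plane.
    - move=> x y /=; rewrite !mul0r !mul1r => -[[? ?] ?]; split=> //.
      by rewrite ler_wpDr.
  move=> z [->|[[i j] nz <-]] /=; first by rewrite mulr0 lexx ler0n.
  rewrite ler0n ler_nat; split.
    by apply: (order_le A n).1 nz; rewrite oA.
  by rewrite /r mulrAC ler_pdivrMr // -!natrM ler_nat [(j * q)%N]mulnC; apply: wA.
move=> [x y] /= [/andP[x0 xn] rxy] D [[_ cD upD] genD].
have D0 : D (0, 0) by apply: genD; left.
have Dn : D (n%:R, k%:R) by apply: genD; right; exists (n, k).
have Dx : D (x, r * x).
  have s01 : 0 <= x / n%:R <= 1.
    by rewrite divr_ge0 ?ler0n //= ler_pdivrMr // mul1r.
  have := convex_comb cD s01 Dn D0; rewrite /= !mulr0 !addr0 divfK ?gt_eqF //.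
  by rewrite -rn mulrCA divfK ?gt_eqF // mulrC.
have DxN N : D (x, r * x + N%:R).
  elim: N => [|N IHN]; first by rewrite addr0.
  by rewrite -natr1 addrA; apply: upD.
have yr : 0 <= y - r * x by rewrite subr_ge0.
(* Translations have integer height, so [(x, y)] is reached as a convex combination of [(x, r * x)]
   and a translate above it. *)
pose N := (Num.bound (y - r * x)).
have yN : y - r * x < N%:R := archi_boundP yr.
have N_gt0 : 0 < N%:R :> R by apply: le_lt_trans yN.
have s01 : 0 <= (y - r * x) / N%:R <= 1.
  by rewrite divr_ge0 ?ler0n //= ler_pdivrMr // mul1r ltW.
have := convex_comb cD s01 (DxN N) Dx; rewrite /=.
congr (D (_, _)); set s := _ / N%:R; first by rewrite -mulrDl addrC subrK mul1r.
have -> : s * (r * x + N%:R) + (1 - s) * (r * x) = s * N%:R + r * x by ring.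
by rewrite divfK ?gt_eqF // subrK.
Qed.

End Slopes.

(** * Reading the characteristic polynomial off the operator *)

Section CharacteristicPolynomial.
Variable R : realType.
Local Notation C := R[i].

Lemma coef_var_monomial (sigma : {poly C}) (p q s : nat) : (0 < q)%N ->
  ((map_poly (polyC \o polyC) sigma).[var_t R ^+ p * var_xi R ^+ q])`_(q * s)`_(p * s)
    = sigma`_s.
Proof.
move=> q_gt0; pose n := maxn (size sigma) s.+1.
rewrite (@horner_coef_wide _ n); last first.
  by rewrite (leq_trans (size_poly _ _)) // leq_maxl.
have sn : (s < n)%N by rewrite leq_maxr.
have term l : ((map_poly (polyC \o polyC) sigma)`_l *
    (var_t R ^+ p * var_xi R ^+ q) ^+ l)`_(q * s)`_(p * s) =
    sigma`_l *+ (l == s).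
  rewrite coef_map /= exprMn -!exprM /var_t -rmorphXn /= mulrA -rmorphM /=.
  rewrite coefCM coefXn eqn_pmul2l // eq_sym.
  have [->|_] := eqVneq l s; last by rewrite mulr0 coef0.
  by rewrite mulr1 coefCM coefXn eqxx mulr1.
rewrite !coef_sum (bigD1 (Ordinal sn)) //= term eqxx big1 ?addr0 // => l ls.
rewrite term; suff -> : (val l == s) = false by [].
by apply: contraNF ls => /eqP e; apply/eqP/val_inj.
Qed.

Lemma weight_ge0 (p q i j : nat) : (0 < q)%N ->
  (0 <= weight (p%:R / q%:R) i j) = (p * i <= q * j)%N.
Proof.
move=> q_gt0; rewrite /weight subr_ge0 mulrAC ler_pdivrMr ?ltr0n //.
by rewrite -!natrM ler_nat [(j * q)%N]mulnC.
Qed.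

Lemma weight_gt0 (p q i j : nat) : (0 < q)%N ->
  (0 < weight (p%:R / q%:R) i j) = (p * i < q * j)%N.
Proof.
move=> q_gt0; rewrite /weight subr_gt0 mulrAC ltr_pdivrMr ?ltr0n //.
by rewrite -!natrM ltr_nat [(j * q)%N]mulnC.
Qed.

(** The constant term has the minimal weight zero and so belongs to the leading part; this forces
    the prefactor [t^j xi^i] to be 1, and the leading part is [sigma] evaluated at [t^p xi^q]. *)
Lemma characteristic_coef (p q : nat) (L : fdo C) sigma s : (0 < q)%N ->
    (forall i j, fcoef L i j != 0 -> (p * i <= q * j)%N) -> fcoef L 0 0 != 0 ->
    characteristic_polynomial p q L sigma ->
  fcoef L (q * s) (p * s) = sigma`_s.
Proof.
move=> q_gt0 wL L00 [c [i [j [ls [_ leadP ->]]]]].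
have minw k : minimal_weight (p%:R / q%:R) L (q * k) (p * k).
  move=> i' j' /wL wij; apply: (@le_trans _ _ 0); last by rewrite weight_ge0.
  by rewrite /weight !natrM mulrA divfK ?subrr // pnatr_eq0 -lt0n.
have i0 : i = 0%N.
  apply/eqP; apply: contraNT L00; rewrite -lt0n => i_gt0.
  have := leadP 0%N 0%N; rewrite asboolT; last by have := minw 0%N; rewrite !muln0.
  move=> <-; rewrite mulrAC [var_xi _]/var_xi coefMXn i_gt0 coef0 //.
have j0 : j = 0%N.
  apply/eqP; apply: contraNT L00; rewrite -lt0n => j_gt0.
  have := leadP 0%N 0%N; rewrite asboolT; last by have := minw 0%N; rewrite !muln0.
  move=> <-; rewrite i0 mulr1 mulrAC mulrC /var_t -rmorphXn coefCM coefXnM j_gt0 //.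
have := leadP (q * s)%N (p * s)%N; rewrite asboolT // => <-.
rewrite i0 j0 !expr0 !mulr1 -(coef_var_monomial _ p s q_gt0).
congr ((_ : {poly {poly C}})`_(q * s)`_(p * s)).
rewrite rmorphM /= hornerM map_polyC hornerC; congr (_ * _).
rewrite rmorph_prod /= horner_prod; apply: eq_bigr => l _.
by rewrite rmorphB /= map_polyC map_polyX !hornerE.
Qed.

End CharacteristicPolynomial.

(** * Ordering the roots *)

Lemma exists_sorting_perm (R : realType) m (f : 'I_m -> R) :
  exists s : 'S_m, forall i j : 'I_m, (i < j)%N -> f (s i) <= f (s j).
Proof.
pose le_f (i j : 'I_m) := f i <= f j.
have le_f_tr : transitive le_f by move=> y x z; apply: le_trans.
have /tuple_permP[s es] : perm_eq (sort le_f (ord_tuple m)) (ord_tuple m).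
  by rewrite perm_sort.
exists s => i j ij.
have nth_s (k : 'I_m) : nth i (sort le_f (ord_tuple m)) k = s k.
  by rewrite es -tnth_nth tnth_mktuple tnth_ord_tuple.
rewrite -(nth_s i) -(nth_s j).
apply: (@sorted_leq_nth _ le_f le_f_tr) => //; rewrite ?inE ?size_sort ?size_tuple //.
- by move=> x; apply: lexx.
- by apply: sort_sorted => x y; apply: le_total.
- exact: ltnW.
Qed.

(** * Properties of a single factor *)

Section Elementary.
Variable R : realType.
Local Notation C := R[i].

Lemma lead_elemE p q (lam : C) :
  lead_elem p q lam = op_t C ^+ p * op_eps C ^+ q - lam%:A.
Proof. by rewrite op_tX op_epsX fdo_monomM eshift_1 mul1r addn0. Qed.

Lemma elementary_factor p q (lam : C) (A : fdo C) : (0 < q)%N -> coprime p q ->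
    lam != 0 -> filt p q q 1 (A - lead_elem p q lam) ->
  [/\ irreducible_op A, single_slope A (p%:R / q%:R) & elementary_form p q lam A].
Proof.
move=> q_gt0 cop_pq lam_neq0 fA; split.
- exact: elem_irreducible fA.
- have fE : filt p q q 0 (lead_elem p q lam) := @filt_lead_elem _ p q lam.
  have fA0 : filt p q q 0 A.
    rewrite -(subrK (lead_elem p q lam) A); apply: filtD => //.
    by apply: filtW fA.
  have Aqp : fcoef A q p != 0 by rewrite (elem_top_coef q_gt0 fA) oner_eq0.
  apply: (@single_slope_intro _ p q q p) => //; first by rewrite mulnC.
    apply/eqP; rewrite eqn_leq; apply/andP; split.
      by apply/order_le => i j /fA0[].
    exact: (order_le A _).1 (leqnn _) _ _ Aqp.
  by move=> i j /fA0[].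
- move=> i k; rewrite -lead_elemE => /fA[_] w.
  by rewrite weight_gt0.
Qed.

End Elementary.

(** The factors have leading part [t^p eps^q - lambda], so the scalar [lead_coef sigma] stays in
    front. For slope zero, integer shifts of roots may meet other roots, and [s] records an order of
    the factors that avoids this; for positive slope the given order is kept. The constant term of
    [L] gives its leading part no monomial prefactor. *)
Theorem theorem2 (R : realType) (p q m : nat) (L : fdo R[i])
    (sigma : {poly R[i]}) (lambda : 'I_m -> R[i]) :
  (0 < q)%N -> coprime p q ->
  single_slope L (p%:R / q%:R) ->
  support_op L (0%N, 0%N) ->
  characteristic_polynomial p q L sigma ->
  sigma = lead_coef sigma *: \prod_(j < m) ('X - (lambda j)%:P) ->
  injective lambda ->
  exists (s : 'S_m) (Lf : 'I_m -> fdo R[i]),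
    [/\ (0 < p)%N -> s = 1%g,
        L = lead_coef sigma *: \prod_(j < m) Lf j &
        forall j : 'I_m,
          [/\ irreducible_op (Lf j),
              single_slope (Lf j) (p%:R / q%:R) &
              elementary_form p q (lambda (s j)) (Lf j)]].
Proof.
move=> q_gt0 cop_pq slopeL L00 charL sigmaE lam_inj.
have [wL [jn [nzn en]]] := newton_polygon_vertex q_gt0 slopeL.
have coefL k := characteristic_coef k q_gt0 wL L00 charL.
set lc := lead_coef sigma in sigmaE *; set P := \prod_(j < m) _ in sigmaE.
have sigma0 : sigma`_0 != 0 by rewrite -coefL !muln0.
have lc_neq0 : lc != 0.
  by rewrite lead_coef_eq0; apply: contraNneq sigma0 => ->; rewrite coef0.
have lam_neq0 j : lambda j != 0.
  apply: contraNneq sigma0 => lam0; rewrite sigmaE coefZ -horner_coef0.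
  rewrite horner_prod (bigD1 j) //= lam0 subr0 hornerX mul0r mulr0 //.
have szP : size P = m.+1.
  by rewrite size_prod_XsubC /index_enum -enumT size_enum_ord.
(* The vertex of the polygon at the order of [L] is some [(q * k, p * k)], whose coefficient is that
   of degree [k] in [sigma]; hence [k <= m]. *)
have oL : (Defs.order L <= q * m)%N.
  have : (q %| p * Defs.order L)%N by rewrite en dvdn_mulr.
  rewrite Gauss_dvdr 1?coprime_sym // => /dvdnP[k ek].
  have ejn : jn = (p * k)%N.
    by apply/eqP; rewrite -(eqn_pmul2l q_gt0) -en ek; apply/eqP; lia.
  move: nzn; rewrite ek ejn [(k * q)%N]mulnC coefL sigmaE coefZ mulf_eq0 negb_or.
  case/andP=> _ Pk; rewrite leq_mul2l -ltnS -szP ltnNge orbC.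
  by apply/orP; left; apply: contra Pk => ?; rewrite nth_default.
(* Without roots the order would be zero, which [single_slope] excludes. *)
case: m => [|m] in lambda lam_inj P sigmaE lam_neq0 szP oL *.
  by case: slopeL; move: oL; rewrite muln0 leqn0 => /eqP->.
have [s [s1 nores]] : exists s : 'S_m.+1, ((0 < p)%N -> s = 1%g) /\
    forall (i j : 'I_m.+1) d, (i < j)%N -> (0 < d)%N ->
      shifted_root p d (lambda (s i)) != lambda (s j).
  have [p0|p_gt0] := posnP p; last first.
    exists 1%g; split=> // i j d ij _; rewrite !perm1 /shifted_root gtn_eqF //.
    by rewrite (inj_eq lam_inj) neq_ltn ij.
  (* With real parts nondecreasing along [s], subtracting [d > 0] from an earlier root makes its
     real part strictly smaller than that of any later one. *)
  have [s sP] := exists_sorting_perm (fun i => complex.Re (lambda i)).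
  exists s; split=> // i j d ij d_gt0; rewrite /shifted_root p0 eqxx.
  apply/eqP => e; have := sP _ _ ij; rewrite -e -(rmorph_nat (real_complex R)).
  by case: (lambda (s i)) => x y /=; rewrite lerBrDl gerDr leNgt ltr0n d_gt0.
pose lamn j := lambda (s (inord j)).
pose L1 := lc^-1 *: L.
have fL1 : filt p q (q * m.+1) 0 L1.
  apply: filtZ => i j nz; split; last by rewrite add0n wL.
  by apply: leq_trans oL; apply: (order_le L _).1 nz.
have leadL1 k : fcoef L1 (q * k) (p * k) = (\prod_(j < m.+1) ('X - (lamn j)%:P))`_k.
  rewrite fcoefZ coefL sigmaE coefZ mulKf //; congr ((_ : {poly _})`_k).
  rewrite /P (reindex_inj (@perm_inj _ s)); apply: eq_bigr => j _.
  by rewrite /lamn inord_val.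
have [|Lf [L1E fLf]] := factor_chain q_gt0 cop_pq _ fL1 leadL1.
  move=> i j d /andP[ij jm]; apply: nores; rewrite !inordK //; lia.
exists s, (fun j => Lf j); split=> // [|j].
  by rewrite -L1E scalerA divff // scale1r.
apply: elementary_factor => //.
by have := fLf j (leq_ord j); rewrite /lamn inord_val.
Qed.
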